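(* Let $n$ and $k$ be positive integers. The following statements are true. (1) For any $\lambda = (\lambda_{1}, \lambda_{2}, n, n, \ldots, n) \in \tilde{\Lambda}_{n}^{k}$ (with $kn-2$ trailing entries $n$) with $\lambda_{1} \leq \lambda_{2} < n$, we have $$m_{\lambda}(\zeta_{(n,k)}) = \begin{cases} -\frac{n}{2}k \neq 0, & \lambda_1 = \lambda_2, \\ -kn \neq 0, & \lambda_1 \neq \lambda_2. \end{cases}$$ (2) For any $\lambda = (\lambda_{1}, \lambda_{1}, \lambda_{1}, n, n, \ldots, n) \in \tilde{\Lambda}_{n}^{k}$ (with $kn-3$ trailing entries $n$) with $\lambda_1 < n$, we have $m_{\lambda}(\zeta_{(n,k)}) = \frac{n}{3}k \neq 0$. (3) For any $\lambda \in \tilde{\Lambda}_{n}^{k}$ of either of the forms $\lambda = (\lambda_1, \lambda_1, \lambda_2, n, n, \ldots, n)$ or $\lambda = (\lambda_1, \lambda_2, \lambda_2, n, n, \ldots, n)$ (with $kn-3$ trailing entries $n$), where $\lambda_1 < \lambda_2 < n$, we have $m_{\lambda}(\zeta_{(n,k)}) = kn \neq 0$. (4) For any $\lambda = (\lambda_1, \lambda_2, \lambda_3, n, n, \ldots, n) \in \tilde{\Lambda}_{n}^{k}$ (with $kn-3$ trailing entries $n$) with $\lambda_1 < \lambda_2 < \lambda_3 < n$, we have $m_{\lambda}(\zeta_{(n,k)}) = 2kn \neq 0$. (5) For any $\lambda = (\lambda_1, \ldots, \lambda_1, n, \ldots, n) \in \mathbb{Z}^{kn}$, consisting of $a$ entries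 equal to $\lambda_1$ followed by $kn-a$ entries equal to $n$, with $n \nmid \lambda_1$, $n \mid a\lambda_1$ and $0 \leq a \leq kn$, we have $$m_{\lambda}(\zeta_{(n,k)}) = (-1)^{a + \frac{a}{n}\gcd(\lambda_1, n)} \binom{k\gcd(\lambda_1, n)}{\frac{a}{n}\gcd(\lambda_1, n)} \neq 0.$$ (6) For any $\lambda = (\lambda_1, \ldots, \lambda_1, \lambda_2, \ldots, \lambda_2) \in \mathbb{Z}^{kn}$, consisting of $a$ entries equal to $\lambda_1$ followed by $kn-a$ entries equal to $\lambda_2$, with $n \nmid \lambda_2 - \lambda_1$ and $1 \leq a \leq kn$, we have $$m_{\lambda}(\zeta_{(n,k)}) = (-1)^{k(n+1)\lambda_1}\, m_{\lambda'}(\zeta_{(n,k)}),$$ where $\lambda' := (\lambda_2-\lambda_1, \ldots, \lambda_2-\lambda_1, n, \ldots, n)$ consists of $kn-a$ entries equal to $\lambda_2-\lambda_1$ followed by $a$ entries equal to $n$. (7) Let $l$ be a positive integer. For $\lambda = (\lambda_1, \ldots, \lambda_{kn}) \in \Lambda_n^k$ and $\mu = (\mu_1, \ldots, \mu_{(k+l)n}) \in \Lambda_n^{k+l}$, write $\lambda \triangleleft \mu$ if $$|\{ i \mid \lambda_i = b,\ 1 \leq i \leq kn \}| \leq |\{ i \mid \mu_i = b,\ 1 \leq i \leq (k+l)n \}| \quad \text{for every } 1 \leq b \leq n,$$ and in this case let $\mu \backslash \lambda \in \Lambda_n^l$ be the sequence obtained by removing the entries $\lambda_i$ (with multiplicity)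 from $\mu$. Then, for any $\mu \in \Lambda_n^{k+l}$, $$m_{\mu}(\zeta_{(n,k+l)}) = \sum_{\substack{\lambda \in \Lambda_n^k \\ \lambda \triangleleft \mu}} m_{\lambda}(\zeta_{(n,k)})\, m_{\mu \backslash \lambda}(\zeta_{(n,l)}).$$
   Context: For a positive integer $N$, the symmetric group $\mathfrak{S}_N$ acts on $\mathbb{Z}^N$ by $\sigma\cdot\lambda := (\lambda_{\sigma^{-1}(1)}, \ldots, \lambda_{\sigma^{-1}(N)})$. For $\lambda \in \mathbb{Z}^N$, the monomial symmetric (Laurent) polynomial is $$m_\lambda(x) := \sum_{\mu \in \mathfrak{S}_N\cdot\lambda} x^\mu \in \mathbb{C}[x_1^{\pm 1}, \ldots, x_N^{\pm 1}], \qquad x^\mu := x_1^{\mu_1}\cdots x_N^{\mu_N},$$ where the sum is over the orbit $\mathfrak{S}_N\cdot\lambda = \{\sigma\cdot\lambda \mid \sigma \in \mathfrak{S}_N\}$ as a set, so each distinct rearrangement of $\lambda$ is counted once. For positive integers $n,k$, let $\zeta_n$ be a primitive complex $n$th root of unity and $\zeta_{(n,k)} := (1, \zeta_n, \zeta_n^2, \ldots, \zeta_n^{kn-1}) \in \mathbb{C}^{kn}$; for $\lambda\in\mathbb{Z}^{kn}$, $m_\lambda(\zeta_{(n,k)})$ is the value of $m_\lambda$ (in $N = kn$ variables) at this point. For positive integers $n,k$, $$\Lambda_n^k := \{(\lambda_1, \ldots, \lambda_{kn}) \in \mathbb{Z}^{kn} \mid 1 \leq \lambda_1 \leq \lambda_2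 \leq \cdots \leq \lambda_{kn} \leq n\},\qquad \tilde{\Lambda}_n^k := \{\lambda \in \Lambda_n^k \mid |\lambda| \equiv 0 \pmod n\},$$ where $|\lambda| := \lambda_1 + \lambda_2 + \cdots + \lambda_{kn}$. *)

(* Defs.v *)
From HB Require Import structures.
From mathcomp Require Import all_boot all_order all_algebra fingroup perm.
From mathcomp Require Import complex.
From mathcomp Require Import boolp classical_sets functions cardinality fsbigop reals.

Set Implicit Arguments.
Unset Strict Implicit.
Unset Printing Implicit Defensive.

Import Order.TTheory GRing.Theory Num.Theory.

Local Open Scope ring_scope.

Section MonomialSymmetric.
Variable N : nat.

Definition perm_tuple_act (s : 'S_N) (lam : N.-tuple int) : N.-tuple int :=
  [tuple tnth lam ((s^-1)%g i) | i < N].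

Definition perm_orbit (lam : N.-tuple int) : seq (N.-tuple int) :=
  undup [seq perm_tuple_act s lam | s : 'S_N].

Definition laurent_monomial (R : unitRingType) (mu : N.-tuple int)
    (x : N.-tuple R) : R :=
  \prod_(i < N) tnth x i ^ tnth mu i.

Definition monomial_sym (R : unitRingType) (lam : N.-tuple int)
    (x : N.-tuple R) : R :=
  \sum_(mu <- perm_orbit lam) laurent_monomial mu x.

End MonomialSymmetric.

Definition zeta_point (R : unitRingType) (z : R) (n k : nat) :
    (k * n).-tuple R :=
  [tuple z ^+ i | i < k * n].

Definition Lambda (n k : nat) : {pred (k * n).-tuple int} :=
  [pred lam : (k * n).-tuple int |
    sorted <=%R lam & all (fun x => 1 <= x <= n%:Z) lam].
Arguments Lambda : clear implicits.

Definition tLambda (n k : nat) : {pred (k * n).-tuple int} :=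
  [pred lam | (lam \in Lambda n k) && (n %| \sum_(i < k * n) tnth lam i)%Z].
Arguments tLambda : clear implicits.

Definition triangleleft (n k l : nat) (lam : (k * n).-tuple int)
    (mu : ((k + l) * n).-tuple int) : Prop :=
  forall b : nat, (1 <= b <= n)%N ->
    (#|[set i | tnth lam i == b%:Z]| <= #|[set i | tnth mu i == b%:Z]|)%N.

(* Multiset difference: [rem x u] deletes one occurrence of x from u. *)
Definition seq_removal (s t : seq int) : seq int :=
  foldr (fun x u => rem x u) s t.

(* [insubd] returns its first argument when the sequence does not have length
   l * n; [val_removal] shows that this does not happen when
   [triangleleft lam mu] holds. *)
Definition removal (n k l : nat) (mu : ((k + l) * n).-tuple int)
    (lam : (k * n).-tuple int) : (l * n).-tuple int :=
  insubd (nseq_tuple (l * n) 0) (seq_removal mu lam).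

Lemma finite_Lambda n k : finite_set [set lam | lam \in Lambda n k]%classic.
Proof.
pose f (t : (k * n).-tuple 'I_n.+1) : (k * n).-tuple int :=
  map_tuple (fun i : 'I_n.+1 => (i : nat)%:Z) t.
apply: (@sub_finite_set _ _ (f @` [set: (k * n).-tuple 'I_n.+1])%classic);
  last by apply: finite_image; exact: finite_finset.
move=> lam /= /andP[_ /allP lamb].
exists (map_tuple (fun x : int => inord `|x|%N) lam) => //.
apply: val_inj; rewrite /= -map_comp -[RHS]map_id.
apply/eq_in_map => x /lamb /=; case: x => // m /andP[_ mn].
by rewrite inordK.
Qed.

Lemma card_tnth (N : nat) (lam : N.-tuple int) (b : int) :
  #|[set i | tnth lam i == b]| = count_mem b lam.
Proof.
rewrite cardsE cardE -[in RHS](map_tnth_enum lam) count_map.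
by rewrite size_filter -enumT; apply: eq_count.
Qed.

Lemma perm_removal (s t : seq int) :
  (forall b, count_mem b t <= count_mem b s)%N ->
  perm_eq (t ++ seq_removal s t) s.
Proof.
elim: t => //= x t IH Hc.
have Ht : perm_eq (t ++ seq_removal s t) s.
  by apply: IH => b; apply: leq_trans (Hc b); exact: leq_addl.
have xin : x \in seq_removal s t.
  rewrite -has_pred1 has_count.
  have /seq.permP/(_ (pred1 x)) := Ht; rewrite count_cat => E.
  by have := Hc x; rewrite eqxx -E add1n -addn1 leq_add2l.
apply: perm_trans Ht; rewrite -cat_cons -cat1s -catA perm_sym perm_catC.
rewrite perm_sym perm_catCA perm_catC perm_cat2r //.
by rewrite perm_sym perm_to_rem.
Qed.

Lemma subseq_removal (s t : seq int) :
  subseq (seq_removal s t) s.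
Proof.
by elim: t => //= x t IH; apply: subseq_trans IH; exact: rem_subseq.
Qed.

Lemma val_removal n k l (mu : ((k + l) * n).-tuple int)
    (lam : (k * n).-tuple int) :
  lam \in Lambda n k -> triangleleft lam mu ->
  perm_eq (lam ++ removal mu lam) mu /\
  tval (removal mu lam) = seq_removal mu lam.
Proof.
move=> /andP[_ /allP lamb] lm.
have Hc b : (count_mem b lam <= count_mem b mu)%N.
  case: (boolP (b \in tval lam)) => [bl|]; last by move/count_memPn ->.
  have := lamb b bl; case: b {bl} => // b bn.
  by have := lm b bn; rewrite !card_tnth.
have Hp := perm_removal Hc.
suff E : tval (removal mu lam) = seq_removal mu lam.
  by rewrite E.
have sz : size (seq_removal mu lam) == (l * n)%N.
  have /perm_size/eqP := Hp.
  by rewrite size_cat !size_tuple [X in _ == X]mulnDl eqn_add2l.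
by rewrite /removal -[LHS]/(val _) val_insubd sz.
Qed.

Lemma removal_Lambda n k l (mu : ((k + l) * n).-tuple int)
    (lam : (k * n).-tuple int) :
  mu \in Lambda n (k + l) -> lam \in Lambda n k -> triangleleft lam mu ->
  removal mu lam \in Lambda n l.
Proof.
move=> /andP[mus /allP mub] laml lm.
have [_ E] := val_removal laml lm; have S := subseq_removal mu lam.
apply/andP; split; rewrite /= E.
  exact: (subseq_sorted le_trans S).
by apply/allP => x xin; apply: mub; exact: (mem_subseq S).
Qed.

(* Main.v *)
Require Import Defs.
From HB Require Import structures.
From mathcomp Require Import all_boot all_order all_algebra fingroup perm.
From mathcomp Require Import complex.
From mathcomp Require Import boolp classical_sets functions cardinality fsbigop reals.
From mathcomp Require Import zify ring.

Set Implicit Arguments.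
Unset Strict Implicit.
Unset Printing Implicit Defensive.

Import Order.TTheory GRing.Theory Num.Theory.

Local Open Scope ring_scope.

(** Write p_v for the v-th power sum of the variables. At the point
    (1, z, ..., z^(kn-1)) it equals kn when n divides v and vanishes otherwise,
    and exponents equal to n may be replaced by 0.

    Parts (1) to (4): multiplying a monomial symmetric function by p_v adds v to
    one of its exponents ([psum_msym]). If the nonzero exponents are a, b, c, none
    divisible by n but with sum divisible by n, then p_a = 0, so the term where
    a is added to a zero exponent is the negative of the terms where a is added to
    b or to c. These have two nonzero exponents, and the same argument reduces
    them to - p_(a + b + c) = - kn ([zeta_marked2], [zeta_marked3]). The values
    in the theorem differ only by how many coincidences occur among the exponents:
    the multiplicity of a is divided out, and the two reductions become one when
    b = c.

    Part (5): when only two exponents occur, the value is a coefficient of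
    the product over the variables x of x^v + x^w X ([msym_nseq2]). For w = n and
    g = gcd(v, n) it is (X^(n/g) - (-1)^(n/g))^(kg), because z^v is a primitive
    root of unity of order n/g ([coef_prod_zeta]).

    Part (6): subtracting l1 from every exponent multiplies the value by the
    -l1-th power of the product of the variables ([msym_map]), and this product
    is (-1)^(k(n+1)) ([prod_zeta]).

    Part (7): the point for k + l is the concatenation of the points for k and
    for l, because z^(kn) = 1. Cutting the exponent vectors accordingly and
    grouping them by the multiset of entries of the first block gives the
    convolution formula ([msym_cat]). *)

(** * Rearrangements of a list *)

Lemma undup_nseqS (T : eqType) m (x : T) : undup (nseq m.+1 x) = [:: x].
Proof. by elim: m => //= m IH; rewrite mem_head. Qed.

Lemma undup_cons (T : eqType) (x : T) s :
  undup (x :: s) = if x \in s then undup s else x :: undup s.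
Proof. by []. Qed.

Lemma rem_cons (T : eqType) (x y : T) s :
  rem x (y :: s) = if y == x then s else y :: rem x s.
Proof. by []. Qed.

Lemma count_mem_cons (T : eqType) (x y : T) s :
  count_mem x (y :: s) = ((y == x) + count_mem x s)%N.
Proof. by []. Qed.

Lemma perm_set_nth (mu : seq int) i w :
  (i < size mu)%N -> perm_eq (set_nth 0 mu i w) (w :: rem mu`_i mu).
Proof.
move=> imu; apply/seq.permP => p.
rewrite count_set_nth_ltn // /= count_rem mem_nth //= addnC.
case: (boolP (p mu`_i)) => [pi|_]; last by rewrite !subn0.
by rewrite addnBA // -has_count; apply/(has_nthP 0); exists i.
Qed.

Lemma set_nth_same (mu : seq int) i : (i < size mu)%N -> set_nth 0 mu i mu`_i = mu.
Proof.
move=> imu; apply: (@eq_from_nth _ 0).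
  by rewrite size_set_nth; apply/maxn_idPr.
by move=> j _; rewrite nth_set_nth /=; case: eqP => [->|].
Qed.

(** Overwriting is undone by putting the old entry back, so the overwritten lists
    are distinct and all lists with w at position i are reached. *)
Lemma set_nth_permutations (s : seq int) i u w :
  (i < size s)%N -> u \in s ->
  perm_eq [seq set_nth 0 mu i w | mu <- permutations s & mu`_i == u]
          [seq nu <- permutations (w :: rem u s) | nu`_i == w].
Proof.
move=> i_s us.
have size_perm (mu : seq int) : perm_eq mu s -> (i < size mu)%N.
  by move/perm_size ->.
have set_nthK (mu : seq int) v :
    (i < size mu)%N -> set_nth 0 (set_nth 0 mu i v) i mu`_i = mu.
  by move=> imu; rewrite set_set_nth eqxx set_nth_same.
apply: uniq_perm.
- rewrite map_inj_in_uniq ?filter_uniq ?permutations_uniq // => mu nu.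
  rewrite !mem_filter !mem_permutations => /andP[/eqP mui mus].
  move=> /andP[/eqP nui nus] E.
  by rewrite -(set_nthK mu w) ?size_perm // E mui -nui set_nthK ?size_perm.
- by rewrite filter_uniq ?permutations_uniq.
have size_w (nu : seq int) : perm_eq nu (w :: rem u s) -> (i < size nu)%N.
  by move/perm_size ->; rewrite /= size_rem // prednK //; case: (s) us.
move=> nu; rewrite mem_filter mem_permutations; apply/mapP/andP.
  case=> mu; rewrite mem_filter mem_permutations => /andP[/eqP mui mus] ->.
  rewrite nth_set_nth /= eqxx; split => //.
  apply: perm_trans (perm_set_nth w (size_perm _ mus)) _.
  rewrite perm_cons mui -(perm_cons u).
  apply: perm_trans (perm_to_rem us); rewrite perm_sym.
  apply: perm_trans (perm_to_rem _); first by rewrite perm_sym.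
  by rewrite (perm_mem mus).
case=> /eqP nui nus; exists (set_nth 0 nu i u); last first.
  by rewrite -nui set_nthK // size_w.
rewrite mem_filter mem_permutations nth_set_nth /= !eqxx /=.
apply: perm_trans (perm_set_nth u (size_w _ nus)) _.
rewrite nui perm_sym; apply: perm_trans (perm_to_rem us) _.
rewrite perm_cons -(perm_cons w) perm_sym.
apply: (perm_trans _ nus); rewrite perm_sym; apply: perm_to_rem.
by rewrite (perm_mem nus) mem_head.
Qed.

Lemma permutations_nseq (m : nat) (x : int) :
  perm_eq (permutations (nseq m x)) [:: nseq m x].
Proof.
apply: uniq_perm => // [|mu]; first exact: permutations_uniq.
rewrite mem_permutations mem_seq1; apply/idP/eqP => [mux|-> //].
have /all_pred1P : all (pred1 x) mu by rewrite (perm_all _ mux) all_nseq /= eqxx orbT.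
by rewrite (perm_size mux) size_nseq.
Qed.

Lemma permutations_map (s : seq int) (f : int -> int) :
  {in s &, injective f} ->
  perm_eq (permutations (map f s)) (map (map f) (permutations s)).
Proof.
(* The function h is a left inverse of f on s. *)
move=> f_inj; pose h y := s`_(find (fun u => f u == y) s).
have fK : {in s, cancel f h}.
  move=> u us; have us' : has (fun u' => f u' == f u) s by apply/hasP; exists u.
  apply: f_inj => //; first by rewrite mem_nth // -has_find.
  by apply/eqP; exact: (nth_find 0 us').
have mapK t : perm_eq t s -> map h (map f t) = t.
  move=> ts; rewrite -map_comp -[RHS]map_id; apply/eq_in_map => u.
  by rewrite (perm_mem ts); exact: fK.
apply: uniq_perm; first exact: permutations_uniq.
  rewrite map_inj_in_uniq ?permutations_uniq // => t t'.
  by rewrite !mem_permutations => ts t's E; rewrite -(mapK t) // E mapK.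
move=> t; rewrite mem_permutations; apply/idP/mapP => [ts|[t' + ->]]; last first.
  by rewrite mem_permutations => /perm_map->.
exists (map h t).
  by rewrite mem_permutations -[X in perm_eq _ X](mapK s) // perm_map.
rewrite -map_comp -[LHS]map_id; apply/eq_in_map => y.
by rewrite (perm_mem ts) => /mapP[u us ->] /=; rewrite fK.
Qed.

(** * Monomial symmetric functions of lists *)

Definition laurent_eval (F : fieldType) (xs : seq F) (mu : seq int) : F :=
  \prod_(i < size xs) xs`_i ^ mu`_i.

(** [permutations] lists each distinct rearrangement once, so this is the sum
    over the orbit; using lists of any length allows induction on the number of
    variables and splitting the variables in two blocks. *)
Definition msym (F : fieldType) (xs : seq F) (s : seq int) : F :=
  \sum_(mu <- permutations s) laurent_eval xs mu.

Lemma mem_perm_orbit N (lam mu : N.-tuple int) :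
  (mu \in perm_orbit lam) = perm_eq mu lam.
Proof.
rewrite mem_undup; apply/mapP/tuple_permP => [[s _ ->]|[s E]].
  by exists (s^-1)%g.
exists (s^-1)%g; first by rewrite mem_enum.
by apply: val_inj; rewrite [LHS]E /perm_tuple_act invgK.
Qed.

Lemma monomial_symE (F : fieldType) N (lam : N.-tuple int) (x : N.-tuple F) :
  monomial_sym lam x = msym x lam.
Proof.
have E (mu : N.-tuple int) : laurent_monomial mu x = laurent_eval x mu.
  rewrite /laurent_eval size_tuple; apply: eq_bigr => i _.
  by rewrite !(tnth_nth 0).
rewrite /monomial_sym (eq_bigr _ (fun mu _ => E mu)).
rewrite -(big_map val xpredT (laurent_eval x)); apply: perm_big.
apply: uniq_perm; first by rewrite map_inj_uniq ?undup_uniq //; exact: val_inj.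
  exact: permutations_uniq.
move=> mu; rewrite mem_permutations; apply/mapP/idP => [[nu + ->]|mulam].
  by rewrite mem_perm_orbit.
have sz : size mu == N by rewrite (perm_size mulam) size_tuple.
by exists (Tuple sz); rewrite ?mem_perm_orbit.
Qed.

Lemma msym_perm (F : fieldType) (xs : seq F) s t :
  perm_eq s t -> msym xs s = msym xs t.
Proof. by move=> st; apply: perm_big; exact: perm_permutations. Qed.

(** Every monomial picks up the same factor, the product of all values of g,
    since each variable occurs exactly once in it. This covers shifting all
    exponents by a constant, and replacing n by 0 where n-th powers of the
    variables are 1. *)
Lemma msym_map (F : fieldType) (xs : seq F) (s : seq int) f (g : F -> F) :
  size s = size xs -> {in s &, injective f} ->
  {in xs & s, forall x u, x ^ f u = g x * x ^ u} ->
  msym xs (map f s) = (\prod_(x <- xs) g x) * msym xs s.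
Proof.
move=> szs f_inj fg; rewrite /msym (perm_big _ (permutations_map f_inj)).
rewrite big_map mulr_sumr [LHS]big_seq [RHS]big_seq.
apply: eq_bigr => mu; rewrite mem_permutations => mus.
rewrite (big_nth 0) big_mkord -big_split /=; apply: eq_bigr => i _.
have imu : (i < size mu)%N by rewrite (perm_size mus) szs.
by rewrite (nth_map 0) // fg ?mem_nth // -(perm_mem mus) mem_nth.
Qed.

(** * Multiplication by a power sum *)

Definition psum (F : fieldType) (xs : seq F) (v : int) : F :=
  \sum_(x <- xs) x ^ v.

(** The sum of the monomials with one entry equal to w marked in each exponent
    vector. In this normalization the product with a power sum has all
    coefficients 1, whatever coincidences occur among the exponents. *)
Definition marked_msym (F : fieldType) (xs : seq F) (w : int) (s : seq int) : F :=
  (count_mem w s)%:R * msym xs s.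

Lemma marked_msymE (F : fieldType) (xs : seq F) w s : size s = size xs ->
  marked_msym xs w s =
  \sum_(i < size xs) \sum_(nu <- permutations s | nu`_i == w) laurent_eval xs nu.
Proof.
move=> szs; rewrite /marked_msym /msym mulr_sumr.
rewrite [RHS](exchange_big_dep predT) //= [LHS]big_seq [RHS]big_seq.
apply: eq_bigr => nu; rewrite mem_permutations => nus.
rewrite sumr_const mulr_natl; congr (_ *+ _).
have sznu : size nu = size xs by rewrite (perm_size nus).
by rewrite -(seq.permP nus) -sum1_count (big_nth 0) big_mkord sznu sum1_card.
Qed.

Lemma laurent_eval_set_nth (F : fieldType) (xs : seq F) mu (i : 'I_(size xs)) v :
  xs`_i != 0 ->
  laurent_eval xs (set_nth 0 mu i (mu`_i + v)) = xs`_i ^ v * laurent_eval xs mu.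
Proof.
move=> xi0; rewrite /laurent_eval (bigD1 i) //= [in RHS](bigD1 i) //= nth_set_nth /= eqxx.
rewrite expfzDr // mulrA [in RHS](mulrC (xs`_i ^ v)); congr (_ * _).
apply: eq_bigr => j ji; rewrite nth_set_nth /=.
by rewrite (negPf (ji : (j : nat) != i)).
Qed.

(** Multiplying by the power sum adds v to one exponent, in all positions. If
    that exponent was u, the result is a rearrangement of s with one u turned
    into u + v, together with the position of the new entry: a marked
    rearrangement, each obtained exactly once. *)
Lemma psum_msym (F : fieldType) (xs : seq F) v s :
  0 \notin xs -> size s = size xs ->
  psum xs v * msym xs s =
  \sum_(u <- undup s) marked_msym xs (u + v) (u + v :: rem u s).
Proof.
move=> xs0 szs; have xi0 (i : 'I_(size xs)) : xs`_i != 0.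
  by apply: contraNneq xs0 => <-; exact: mem_nth.
transitivity (\sum_(u <- undup s) \sum_(i < size xs)
   \sum_(mu <- permutations s | mu`_i == u) xs`_i ^ v * laurent_eval xs mu).
  rewrite exchange_big /psum (big_nth 0) big_mkord mulr_suml.
  apply: eq_bigr => i _; rewrite mulr_sumr.
  rewrite (exchange_big_dep predT) //= [LHS]big_seq [RHS]big_seq.
  apply: eq_bigr => mu; rewrite mem_permutations => mus.
  rewrite -big_filter (_ : [seq _ <- _ | _] = [:: mu`_i]) ?big_seq1 //.
  rewrite (eq_filter (a2 := pred1 mu`_i)) => [|u]; last exact: eq_sym.
  rewrite filter_pred1_uniq ?undup_uniq // mem_undup -(perm_mem mus).
  by apply: mem_nth; rewrite (perm_size mus) szs.
rewrite [LHS]big_seq [RHS]big_seq; apply: eq_bigr => u; rewrite mem_undup => us.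
rewrite marked_msymE; last by rewrite /= size_rem // -szs prednK //; case: (s) us.
apply: eq_bigr => i _; have i_s : (i < size s)%N by rewrite szs.
rewrite -[RHS]big_filter -(perm_big _ (set_nth_permutations (u + v) i_s us)).
rewrite big_map big_filter; apply: eq_bigr => mu /eqP <-.
by rewrite laurent_eval_set_nth.
Qed.

(** * At most three nonzero exponents *)

Lemma msym_nseq0 (F : fieldType) (xs : seq F) m :
  size xs = m -> msym xs (nseq m 0) = 1.
Proof.
move=> szx; rewrite /msym (perm_big _ (permutations_nseq _ _)) big_seq1.
by apply: big1 => i _; rewrite nth_nseq if_same expr0z.
Qed.

Lemma marked_msym1 (F : fieldType) (xs : seq F) m v :
  0 \notin xs -> size xs = m.+1 ->
  marked_msym xs v (v :: nseq m 0) = psum xs v.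
Proof.
move=> xs0 szx; have := psum_msym v xs0 (etrans (size_nseq m.+1 0) (esym szx)).
by rewrite msym_nseq0 // mulr1 undup_nseqS big_seq1 add0r /=.
Qed.

Lemma msym1 (F : fieldType) (xs : seq F) m v :
  v != 0 -> 0 \notin xs -> size xs = m.+1 ->
  msym xs (v :: nseq m 0) = psum xs v.
Proof.
move=> v0 xs0 szx; rewrite -(marked_msym1 v xs0 szx) /marked_msym.
by rewrite /= eqxx count_nseq /= eq_sym (negPf v0) mul0n mul1r.
Qed.

(** In p_v * m_(u) either v is added to a zero exponent, which is the term
    wanted, or to u, which leaves a single power sum. *)
Lemma marked_msym2 (F : fieldType) (xs : seq F) m v u :
  u != 0 -> 0 \notin xs -> size xs = m.+2 ->
  marked_msym xs v [:: v, u & nseq m 0] =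
  psum xs v * psum xs u - psum xs (u + v).
Proof.
move=> u0 xs0 szx; pose s := u :: nseq m.+1 0.
have szs : size s = size xs by rewrite szx /= size_nseq.
have us : undup s = [:: u; 0].
  by rewrite /s undup_cons undup_nseqS mem_nseq (negPf u0).
have := psum_msym v xs0 szs; rewrite us big_cons big_seq1 msym1 //.
rewrite !rem_cons eqxx (negPf u0) marked_msym1 // add0r => ->.
by rewrite addrC addKr.
Qed.

(** Same principle as for two exponents: the subtracted terms come from adding a
    to b, respectively to c. *)
Lemma marked_msym3 (F : fieldType) (xs : seq F) m a b c :
  b != 0 -> c != 0 -> b != c -> 0 \notin xs -> size xs = m.+3 ->
  marked_msym xs a [:: a, b, c & nseq m 0] =
  psum xs a * msym xs [:: b, c & nseq m.+1 0]
  - marked_msym xs (b + a) [:: b + a, c & nseq m.+1 0]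
  - marked_msym xs (c + a) [:: c + a, b & nseq m.+1 0].
Proof.
move=> b0 c0 bc xs0 szx; pose s := [:: b, c & nseq m.+1 0].
have szs : size s = size xs by rewrite szx /= size_nseq.
have us : undup s = [:: b; c; 0].
  rewrite /s 2!undup_cons undup_nseqS in_cons !mem_nseq.
  by rewrite (negPf b0) (negPf c0) (negPf bc).
have := psum_msym a xs0 szs; rewrite us !big_cons big_nil addr0 => ->.
rewrite add0r !rem_cons !eqxx (negPf b0) (negPf c0) (negPf bc).
by ring.
Qed.

Lemma marked_msym3_same (F : fieldType) (xs : seq F) m a b :
  b != 0 -> 0 \notin xs -> size xs = m.+3 ->
  marked_msym xs a [:: a, b, b & nseq m 0] =
  psum xs a * msym xs [:: b, b & nseq m.+1 0]
  - marked_msym xs (b + a) [:: b + a, b & nseq m.+1 0].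
Proof.
move=> b0 xs0 szx; pose s := [:: b, b & nseq m.+1 0].
have szs : size s = size xs by rewrite szx /= size_nseq.
have us : undup s = [:: b; 0].
  by rewrite /s 2!undup_cons undup_nseqS in_cons !mem_nseq (negPf b0) eqxx.
have := psum_msym a xs0 szs; rewrite us !big_cons big_nil addr0 => ->.
by rewrite add0r !rem_cons !eqxx (negPf b0) addrC addKr.
Qed.

(** * Splitting the variables *)

Lemma laurent_eval_cat (F : fieldType) (xs ys : seq F) a b :
  size a = size xs ->
  laurent_eval (xs ++ ys) (a ++ b) = laurent_eval xs a * laurent_eval ys b.
Proof.
move=> sza; rewrite /laurent_eval size_cat big_split_ord /=; congr (_ * _); apply: eq_bigr => i _.
  by rewrite !nth_cat sza ltn_ord.
by rewrite !nth_cat sza ltnNge leq_addr /= addKn.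
Qed.

Lemma msym_cons (F : fieldType) x (xs : seq F) s : (0 < size s)%N ->
  msym (x :: xs) s = \sum_(u <- undup s) x ^ u * msym xs (rem u s).
Proof.
move=> s_gt0; rewrite /msym (perm_big _ (permutationsE s_gt0)) big_allpairs_dep.
apply: eq_bigr => u _; rewrite mulr_sumr; apply: eq_bigr => mu _.
by rewrite -cat1s -[u :: mu]cat1s laurent_eval_cat // /laurent_eval big_ord1.
Qed.

(** Cut every rearrangement after the first [size xs] entries. The first block is
    a rearrangement of exactly one t i, and then the second one is an arbitrary
    rearrangement of the complementary multiset r i. *)
Lemma msym_cat (F : fieldType) (xs ys : seq F) (s : seq int) (I : eqType)
    (L : seq I) (t r : I -> seq int) :
  {in L, forall i, size (t i) = size xs /\ perm_eq (t i ++ r i) s} ->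
  (forall nu, perm_eq nu s ->
     count (fun i => perm_eq (take (size xs) nu) (t i)) L = 1%N) ->
  msym (xs ++ ys) s = \sum_(i <- L) msym xs (t i) * msym ys (r i).
Proof.
move=> L_split L_uniq.
transitivity (\sum_(nu <- permutations s)
    \sum_(i <- L | perm_eq (take (size xs) nu) (t i)) laurent_eval (xs ++ ys) nu).
  rewrite /msym [LHS]big_seq [RHS]big_seq; apply: eq_bigr => nu.
  by rewrite mem_permutations big_const_seq => /L_uniq ->; rewrite /= addr0.
rewrite (exchange_big_dep predT) //= [LHS]big_seq [RHS]big_seq.
apply: eq_bigr => i /L_split[szt trs].
have sz_t a : perm_eq a (t i) -> size a = size xs by move/perm_size ->.
rewrite /msym big_distrlr /= -big_filter.
transitivity (\sum_(nu <- [seq a ++ b | a <- permutations (t i),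
    b <- permutations (r i)]) laurent_eval (xs ++ ys) nu); last first.
  rewrite big_allpairs_dep [LHS]big_seq [RHS]big_seq; apply: eq_bigr => a.
  rewrite mem_permutations => at_; apply: eq_bigr => b _.
  by rewrite laurent_eval_cat // sz_t.
apply: perm_big; apply: uniq_perm.
- by rewrite filter_uniq // permutations_uniq.
- apply: allpairs_uniq; rewrite ?permutations_uniq //.
  move=> [a b] [a' b'] /allpairsP[[? ?] /= [+ _ [-> ->]]].
  move=> + /allpairsP[[? ?] /= [+ _ [-> ->]]].
  rewrite !mem_permutations => /sz_t sza /sz_t sza' /eqP.
  by rewrite eqseq_cat ?sza ?sza' // => /andP[/eqP -> /eqP ->].
- move=> nu; rewrite mem_filter mem_permutations; apply/andP/allpairsP.
    case=> nut nus; exists (take (size xs) nu, drop (size xs) nu).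
    rewrite /= !mem_permutations cat_take_drop; split => //.
    rewrite -(perm_cat2l (t i)); apply: perm_trans (perm_trans nus _); last first.
      by rewrite perm_sym.
    by rewrite -[X in perm_eq _ X](cat_take_drop (size xs)) perm_cat2r perm_sym.
  case=> -[a b] /= []; rewrite !mem_permutations => at_ br ->.
  rewrite -{1}(sz_t _ at_) take_size_cat //; split => //.
  by apply: perm_trans trs; exact: perm_cat.
Qed.

(** * Two exponents: a generating polynomial *)

(** Expanding the product chooses, for each variable, the exponent v or w; the
    indeterminate counts the choices of w. *)
Lemma msym_nseq2 (F : fieldType) (xs : seq F) v w a b :
  v != w -> (a + b)%N = size xs ->
  msym xs (nseq a v ++ nseq b w) =
  (\prod_(x <- xs) ((x ^ v)%:P + x ^ w *: 'X))`_b.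
Proof.
move=> vw; elim: xs a b => [|x xs IH] a b.
  case: a b => [|a] [|b] // _; rewrite big_nil coef1 /=.
  by rewrite /msym big_seq1 /laurent_eval big_ord0.
pose P := \prod_(x <- xs) ((x ^ v)%:P + x ^ w *: 'X).
(* Without occurrences of v, the coefficient taken is the leading one, and the
   coefficient of P beyond its degree must be discarded. *)
have P_eq0 j : (size xs < j)%N -> P`_j = 0.
  rewrite /P; elim: (xs) j => [|y ys IHs] [|j] //; first by rewrite big_nil coef1.
  move=> /= yj; rewrite big_cons mulrDl coefD mul_polyC coefZ -scalerAl coefZ coefXM.
  by rewrite !IHs ?mulr0 ?addr0 // ltnW.
have coefE j : (\prod_(x <- x :: xs) ((x ^ v)%:P + x ^ w *: 'X))`_j =
    x ^ v * P`_j + x ^ w * (if j == 0%N then 0 else P`_j.-1).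
  by rewrite big_cons -/P mulrDl coefD mul_polyC coefZ -scalerAl coefZ coefXM.
rewrite coefE => /= szab; rewrite msym_cons; last first.
  by rewrite size_cat !size_nseq szab.
case: a szab => [|a] szab.
  rewrite add0n in szab; rewrite szab undup_nseqS big_seq1 /= eqxx.
  by rewrite P_eq0 // mulr0 add0r (IH 0%N).
case: b szab => [|b] szab.
  rewrite cats0 undup_nseqS big_seq1 mulr0 addr0 /= eqxx.
  by rewrite -[nseq a v]cats0 (IH a 0%N) //; case: szab.
have -> : undup (nseq a.+1 v ++ nseq b.+1 w) = [:: v; w].
  rewrite undup_cat !undup_nseqS -[RHS]cat1s; congr (_ ++ _).
  apply/all_filterP/allP => u; rewrite inE => /eqP ->.
  by rewrite mem_nseq (negPf vw).
rewrite big_cons big_seq1.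
have -> : msym xs (rem v (nseq a.+1 v ++ nseq b.+1 w)) = P`_b.+1.
  rewrite -[nseq a.+1 v ++ _]/(v :: (nseq a v ++ nseq b.+1 w)) rem_cons eqxx.
  by rewrite IH //; case: szab.
have -> : msym xs (rem w (nseq a.+1 v ++ nseq b.+1 w)) = P`_b.
  rewrite -(IH a.+1 b); last by move: szab; rewrite addnS => -[].
  apply: msym_perm; apply/seq.permP => p; rewrite count_rem mem_cat !mem_nseq.
  by rewrite !count_cat !count_nseq eqxx orbT /=; case: (p w); case: (p v); lia.
by [].
Qed.

(** * Roots of unity *)

Lemma prim_exprz_eq1 (F : fieldType) n (z : F) (v : int) :
  n.-primitive_root z -> (z ^ v == 1) = (n %| v)%Z.
Proof.
move=> hz; case: v => m; first by rewrite -(prim_order_dvd hz).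
by rewrite NegzE -invr_expz invr_eq1 dvdzE abszN -(prim_order_dvd hz).
Qed.

Lemma prim_root_neq0 (F : fieldType) n (z : F) : n.-primitive_root z -> z != 0.
Proof.
move=> hz; apply/eqP => z0; have /eqP := prim_expr_order hz.
by rewrite z0 expr0n (gtn_eqF (prim_order_gt0 hz)) eq_sym oner_eq0.
Qed.

Lemma prim_root_inv (F : fieldType) n (z : F) :
  n.-primitive_root z -> n.-primitive_root z^-1.
Proof.
move=> hz; have n_gt0 := prim_order_gt0 hz.
have -> : z^-1 = z ^+ n.-1.
  apply: (mulfI (prim_root_neq0 hz)).
  by rewrite divff ?(prim_root_neq0 hz) // -exprS prednK // prim_expr_order.
by rewrite prim_root_exp_coprime // coprimePn.
Qed.

Lemma prim_root_exprz (F : fieldType) n (z : F) (v : int) :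
  n.-primitive_root z -> (n %/ gcdn `|v|%N n).-primitive_root (z ^ v).
Proof.
move=> hz; case: v => m; first exact: (exp_prim_root hz).
rewrite NegzE abszN -exprz_inv; exact: (exp_prim_root (prim_root_inv hz)).
Qed.

(** Substitute - X in the factorization of X^d - 1. *)
Lemma prod_XaddX_prim (F : fieldType) d (y : F) : d.-primitive_root y ->
  \prod_(i < d) ((y ^+ i)%:P + 'X) = 'X^d - ((-1) ^+ d)%:P.
Proof.
move=> hy; have /(congr1 (fun p => (-1) ^+ d * (p \Po - 'X))) := factor_Xn_sub_1 hy.
rewrite big_mkord rmorph_prod /= -{1}[d in (-1) ^+ d]card_ord -prodr_const -big_split /=.
have -> : \prod_(i < d) (- 1 * (('X - (y ^+ i)%:P) \Po - 'X)) =
          \prod_(i < d) ((y ^+ i)%:P + 'X).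
  by apply: eq_bigr => i _; rewrite comp_polyB comp_polyX comp_polyC; ring.
move=> ->; rewrite comp_polyB comp_polyC rmorphXn /= comp_polyX (exprNn 'X) mulrBr mulrA.
by rewrite -exprMn mulrNN mulr1 expr1n mul1r mulr1 rmorphXn rmorphN.
Qed.

Lemma prod_periodic (A : comNzRingType) (F : fieldType) d m (y : F) (f : F -> A) :
  y ^+ d = 1 ->
  \prod_(i < m * d) f (y ^+ i) = (\prod_(i < d) f (y ^+ i)) ^+ m.
Proof.
move=> yd; elim: m => [|m IH]; first by rewrite big_ord0.
rewrite mulSn big_split_ord /= exprS -IH; congr (_ * _).
by apply: eq_bigr => i _; rewrite exprD yd mul1r.
Qed.

Lemma coef_XnaddC_exp (F : fieldType) d m j (c : F) : (0 < d)%N -> (j <= m)%N ->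
  (('X^d + c%:P) ^+ m)`_(d * j) = c ^+ (m - j) *+ 'C(m, j).
Proof.
move=> d_gt0 jm; have -> : ('X^d + c%:P) ^+ m = (c%:P + 'X) ^+ m \Po 'X^d.
  by rewrite rmorphXn /= comp_polyD comp_polyX comp_polyC addrC.
rewrite coef_comp_poly_Xn // dvdn_mulr // mulKn // exprDn coef_sum.
have jm' : (j < m.+1)%N by [].
rewrite (bigD1 (Ordinal jm')) //= big1 => [|i ij].
  by rewrite addr0 coefMn -rmorphXn mul_polyC coefZ coefXn eqxx mulr1.
rewrite coefMn -rmorphXn mul_polyC coefZ coefXn.
rewrite (_ : (j == i) = false) ?mulr0 ?mul0rn //.
by rewrite eq_sym; apply: contraNF ij => /eqP ij; apply/eqP/val_inj.
Qed.

Lemma big_zeta_point (A : Type) (idx : A) (op : Monoid.law idx) (F : fieldType)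
    (z : F) n k (f : F -> A) :
  \big[op/idx]_(x <- zeta_point z n k) f x = \big[op/idx]_(i < k * n) f (z ^+ i).
Proof. by rewrite big_tuple; apply: eq_bigr => i _; rewrite tnth_mktuple. Qed.

Lemma mem_zeta_point (F : fieldType) (z : F) n k x :
  x \in tval (zeta_point z n k) -> exists i, x = z ^+ i.
Proof. by move=> /tnthP[i ->]; exists i; rewrite tnth_mktuple. Qed.

Lemma zeta_point_neq0 (F : fieldType) (z : F) n k :
  n.-primitive_root z -> 0 \notin tval (zeta_point z n k).
Proof.
move=> hz; apply/negP => /mem_zeta_point[i /esym/eqP].
by rewrite expf_eq0 (negPf (prim_root_neq0 hz)) andbF.
Qed.

Lemma zeta_point_cat (F : fieldType) (z : F) n k l : n.-primitive_root z ->
  tval (zeta_point z n (k + l)) = zeta_point z n k ++ zeta_point z n l.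
Proof.
move=> hz; apply: (@eq_from_nth _ 0).
  by rewrite size_cat !size_tuple mulnDl.
move=> i; rewrite size_tuple => i_lt.
have nth_zeta m j : (j < m * n)%N -> (zeta_point z n m)`_j = z ^+ j.
  by move=> jm; rewrite -[j]/(val (Ordinal jm)) -tnth_nth tnth_mktuple.
rewrite nth_zeta // nth_cat size_tuple; case: ltnP => [ik|ki].
  by rewrite nth_zeta.
rewrite nth_zeta; last by rewrite ltn_subLR // -mulnDl.
rewrite -{1}(subnKC ki) exprD mulnC exprM (prim_expr_order hz).
by rewrite expr1n mul1r.
Qed.

(** A geometric sum of ratio z^v. *)
Lemma psum_zeta (F : fieldType) (z : F) n k v : n.-primitive_root z ->
  psum (zeta_point z n k) v = if (n %| v)%Z then (k * n)%:R else 0.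
Proof.
move=> hz; rewrite /psum big_zeta_point.
under eq_bigr do rewrite exprnP exprzAC -exprnP.
rewrite -(prim_exprz_eq1 v hz); case: eqP => [->|/eqP zv].
  by rewrite (eq_bigr (fun=> 1)) ?sumr_const ?card_ord // => i _; rewrite expr1n.
have zv1 : z ^ v - 1 != 0 by rewrite subr_eq0.
apply: (mulfI zv1); rewrite mulr0 -subrX1 mulnC exprM.
rewrite [(z ^ v) ^+ n]exprnP exprzAC -exprnP (prim_expr_order hz) exp1rz.
by rewrite expr1n subrr.
Qed.

(** The constant coefficient of [prod_XaddX_prim], raised to the power k. *)
Lemma prod_zeta (F : fieldType) (z : F) n k : n.-primitive_root z ->
  \prod_(x <- zeta_point z n k) x = (-1) ^+ (k * n.+1).
Proof.
move=> hz; rewrite big_zeta_point (prod_periodic k id) ?(prim_expr_order hz) //.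
rewrite mulnC exprM; congr (_ ^+ _).
have /(congr1 (fun p => p.[0])) := prod_XaddX_prim hz.
rewrite horner_prod; under eq_bigr do rewrite !hornerE.
move=> ->; rewrite !hornerE expr0n (gtn_eqF (prim_order_gt0 hz)).
by rewrite sub0r exprS mulN1r.
Qed.

Lemma zeta_exprz_order (F : fieldType) (z : F) n k : n.-primitive_root z ->
  {in tval (zeta_point z n k), forall x, x ^ n%:Z = 1}.
Proof.
move=> hz _ /mem_zeta_point[i ->].
by rewrite -exprnP exprAC (prim_expr_order hz) expr1n.
Qed.

(** * Evaluation at the roots of unity *)

Lemma monomial_sym_zeta_pad (F : fieldType) (z : F) n k m
    (lam : (k * n).-tuple int) (s : seq int) : n.-primitive_root z ->
  tval lam = s ++ nseq m n%:Z -> n%:Z \notin s -> 0 \notin s ->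
  monomial_sym lam (zeta_point z n k) = msym (zeta_point z n k) (s ++ nseq m 0).
Proof.
move=> hz lamE ns zs; pose f (u : int) := if u == 0 then n%:Z else u.
have fE : tval lam = map f (s ++ nseq m 0).
  rewrite lamE map_cat map_nseq /f eqxx; congr (_ ++ _).
  rewrite -[LHS]map_id; apply/eq_in_map => u us; rewrite ifN //.
  by apply: contraNneq zs => <-.
rewrite monomial_symE fE (msym_map (g := fun=> 1)).
- by rewrite big1 ?mul1r.
- by rewrite -(size_map f) -fE !size_tuple.
- have in_s u : u \in s ++ nseq m 0 -> u != 0 -> u \in s.
    by rewrite mem_cat mem_nseq => /orP[//|/andP[_ /eqP ->]]; rewrite eqxx.
  move=> u v us vs; rewrite /f; case: eqP => [->|/eqP u0]; case: eqP => [->|/eqP v0] //.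
    by move=> nv; case/negP: ns; rewrite nv in_s.
  by move=> un; case/negP: ns; rewrite -un in_s.
- move=> x u xz _; rewrite mul1r /f; case: eqP => [->|//].
  by rewrite (zeta_exprz_order hz xz) expr0z.
Qed.

Lemma tLambda_pad n k m (lam : (k * n).-tuple int) (s : seq int) :
  lam \in tLambda n k -> tval lam = s ++ nseq m n%:Z ->
  {in s, forall x, 1 <= x <= n%:Z} /\ (n %| \sum_(x <- s) x)%Z.
Proof.
move=> /andP[/andP[_ /allP lamb] lam_n] lamE; split=> [x xs|].
  by apply: lamb; rewrite lamE mem_cat xs.
have n_pad j : (n %| \sum_(x <- nseq j n%:Z) x)%Z.
  by elim: j => [|j IH]; rewrite /= ?big_nil ?dvdz0 // big_cons rpredDl.
move: lam_n; rewrite /= -(big_tuple _ _ lam xpredT id) lamE big_cat /=.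
by rewrite rpredDr.
Qed.

(** Since n divides neither a nor b, the power sums p_a and p_b vanish, and only
    - p_(a + b) survives. *)
Lemma zeta_marked2 (F : fieldType) (z : F) n k m a b : n.-primitive_root z ->
  (k * n)%N = m.+2 -> ~~ (n %| a)%Z -> ~~ (n %| b)%Z -> (n %| a + b)%Z ->
  marked_msym (zeta_point z n k) a [:: a, b & nseq m 0] = - (k * n)%:R.
Proof.
move=> hz szm na nb nab; have b0 : b != 0 by apply: contraNneq nb => ->.
rewrite marked_msym2 ?zeta_point_neq0 ?size_tuple // !psum_zeta //.
by rewrite (negPf na) [b + a]addrC nab mul0r sub0r.
Qed.

(** The power sum p_a vanishes, so minus the terms where a was added to b or to
    c remain; each is covered by the two-exponent case, and there is only one
    such term when b = c. Only the multiplicity of the marked entry a must still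
    be divided out to get the value of m_lambda. *)
Lemma zeta_marked3 (F : fieldType) (z : F) n k m a b c : n.-primitive_root z ->
  (k * n)%N = m.+3 -> ~~ (n %| a)%Z -> ~~ (n %| b)%Z -> ~~ (n %| c)%Z ->
  (n %| a + b + c)%Z ->
  marked_msym (zeta_point z n k) a [:: a, b, c & nseq m 0] =
  (if b == c then 1 else 2) * (k * n)%:R.
Proof.
move=> hz szm na nb nc nabc.
have [b0 c0] : b != 0 /\ c != 0.
  by split; [apply: contraNneq nb | apply: contraNneq nc] => ->.
have nab : ~~ (n %| b + a)%Z.
  by apply: contra nc => nab; rewrite -(rpredDl _ nab) [b + a]addrC.
have nac : ~~ (n %| c + a)%Z.
  by apply: contra nb => nac; rewrite -(rpredDl _ nac) [c + a]addrC addrAC.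
have zeta_merge x y : ~~ (n %| x)%Z -> ~~ (n %| y)%Z -> (n %| x + y)%Z ->
    marked_msym (zeta_point z n k) x [:: x, y & nseq m.+1 0] = - (k * n)%:R.
  exact: zeta_marked2.
have psum_a : psum (zeta_point z n k) a = 0 by rewrite psum_zeta // (negPf na).
have nbac : (n %| b + a + c)%Z by rewrite [b + a]addrC.
case: eqP => [bc|/eqP bc].
  rewrite -bc in nbac *.
  rewrite marked_msym3_same ?zeta_point_neq0 ?size_tuple // zeta_merge // psum_a.
  by rewrite mul0r sub0r opprK mul1r.
rewrite marked_msym3 ?zeta_point_neq0 ?size_tuple // !zeta_merge // ?psum_a.
  by rewrite mul0r sub0r !opprK mulr2n mulrDl !mul1r.
by rewrite [c + a]addrC addrAC.
Qed.

(** With d = n / g, the power z^v has order d and the product runs kg times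
    through its powers, so it is (X^d - (-1)^d)^(kg). The hypothesis says that
    a = d * b; the coefficient at d * (kg - b) is given by the binomial
    formula. *)
Lemma coef_prod_zeta (F : fieldType) (z : F) n k v a : n.-primitive_root z ->
  (n %| a%:Z * v)%Z -> (a <= k * n)%N ->
  let g := gcdn `|v|%N n in let b := ((a * g) %/ n)%N in
  (\prod_(x <- zeta_point z n k) ((x ^ v)%:P + 'X))`_(k * n - a) =
    (-1) ^+ (a + b) * 'C(k * g, b)%:R /\ (b <= k * g)%N.
Proof.
move=> hz n_av a_le g b; have n_gt0 := prim_order_gt0 hz.
have g_gt0 : (0 < g)%N by rewrite gcdn_gt0 n_gt0 orbT.
pose d := (n %/ g)%N; have nE : n = (g * d)%N by rewrite mulnC divnK // dvdn_gcdr.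
have d_gt0 : (0 < d)%N by move: n_gt0; rewrite nE muln_gt0 => /andP[].
have hy : d.-primitive_root (z ^ v) := prim_root_exprz v hz.
have aE : a = (d * b)%N.
  have : (d %| a)%N.
    rewrite (prim_order_dvd hy) exprnP exprz_exp mulrC.
    by rewrite (prim_exprz_eq1 _ hz).
  case/dvdnP => q aq; suff -> : b = q by rewrite aq mulnC.
  by rewrite /b aq -mulnA [(d * g)%N]mulnC -nE mulnK.
have b_le : (b <= k * g)%N.
  by move: a_le; rewrite aE {1}nE mulnA [(_ * d)%N]mulnC leq_pmul2l.
split => //; rewrite big_zeta_point.
under eq_bigr do rewrite exprnP exprzAC -exprnP.
have knE : (k * n = k * g * d)%N by rewrite nE mulnA.
rewrite knE (prod_periodic _ (fun x => x%:P + 'X) (prim_expr_order hy)).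
rewrite prod_XaddX_prim // -rmorphN.
have -> : (k * g * d - a = d * (k * g - b))%N by rewrite aE mulnC mulnBr.
rewrite coef_XnaddC_exp // ?leq_subr // subKn // bin_sub // mulr_natr; congr (_ *+ _).
by rewrite aE -mulN1r -exprS -exprM mulSn addnC.
Qed.

(** The only candidate is the sorted prefix: elements of Lambda are sorted, hence
    determined by their multiset of entries. *)
Lemma count_Lambda_prefix n k l (mu : ((k + l) * n).-tuple int) (nu : seq int) :
  mu \in Lambda n (k + l) -> perm_eq nu mu ->
  count (fun lam : (k * n).-tuple int => perm_eq (take (k * n) nu) lam)
    (finmap.enum_fset (fset_set
      [set lam | lam \in Lambda n k /\ triangleleft lam mu]%classic)) = 1%N.
Proof.
move=> /andP[_ /allP mub] numu; pose p := take (k * n) nu.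
have szp : size (sort <=%R p) == (k * n)%N.
  rewrite size_sort size_takel // (perm_size numu) size_tuple.
  by rewrite leq_mul2r leq_addr orbT.
pose lam0 : (k * n).-tuple int := Tuple szp.
have lam0p : perm_eq lam0 p by rewrite perm_sort.
set A := [set lam | _]%classic.
have A_fin : finite_set A.
  by apply: sub_finite_set (finite_Lambda n k) => lam [].
have lam0A : A lam0.
  split; last first.
    move=> b _; rewrite !card_tnth (seq.permP lam0p) -(seq.permP numu).
    by rewrite -(cat_take_drop (k * n) nu) count_cat leq_addr.
  apply/andP; split; first by apply: sort_sorted; exact: le_total.
  apply/allP => x; rewrite (perm_mem lam0p) => /mem_take.
  by rewrite (perm_mem numu) => /mub.
rewrite (eq_in_count (a2 := pred1 lam0)) => [|lam].
  rewrite count_uniq_mem; last exact: finmap.fset_uniq.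
  by rewrite (in_fset_set A_fin) mem_set.
rewrite (in_fset_set A_fin) inE => -[/andP[lam_sorted _] _] /=.
apply/idP/eqP => [plam|->]; last by rewrite perm_sym.
apply: val_inj; apply: (sorted_eq le_trans le_anti) => //.
  by apply: sort_sorted; exact: le_total.
by rewrite perm_sym; apply: perm_trans plam.
Qed.

Lemma monomial_sym_tLambda (F : fieldType) (z : F) n k m a s
    (lam : (k * n).-tuple int) : n.-primitive_root z -> lam \in tLambda n k ->
  tval lam = (a :: s) ++ nseq m n%:Z -> {in a :: s, forall x, x < n%:Z} ->
  [/\ {in a :: s, forall x, ~~ (n %| x)%Z}, (n %| \sum_(x <- a :: s) x)%Z,
      (k * n)%N = ((size s).+1 + m)%N &
      (count_mem a (a :: s))%:R * monomial_sym lam (zeta_point z n k) =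
      marked_msym (zeta_point z n k) a (a :: s ++ nseq m 0)].
Proof.
move=> hz lam_t lamE s_lt; have [bnd dvd] := tLambda_pad lam_t lamE.
have ndvd : {in a :: s, forall x, ~~ (n %| x)%Z}.
  move=> x xs; move: (bnd x xs) (s_lt x xs).
  by case: x {xs} => // -[|j] // _ jn; rewrite dvdzE /= gtnNdvd.
split=> //.
  by rewrite -[LHS](size_tuple lam) lamE size_cat size_nseq.
rewrite (monomial_sym_zeta_pad hz lamE).
- rewrite /marked_msym -cat_cons count_cat count_nseq.
  (* The padding does not contribute to the multiplicity of a. *)
  suff -> : pred1 a 0 = false by rewrite mul0n addn0.
  by apply: contraNF (ndvd a (mem_head _ _)) => /eqP <-; rewrite dvdz0.
- by apply/negP => /ndvd; rewrite dvdzz.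
- by apply/negP => /ndvd; rewrite dvdz0.
Qed.

(** The factor on the left is the multiplicity of the marked entry a. *)
Lemma monomial_sym_pair (F : fieldType) (z : F) n k m a b
    (lam : (k * n).-tuple int) : n.-primitive_root z -> lam \in tLambda n k ->
  tval lam = [:: a; b] ++ nseq m n%:Z -> a < n%:Z -> b < n%:Z ->
  (b == a).+1%:R * monomial_sym lam (zeta_point z n k) = - (k * n)%:R.
Proof.
move=> hz lam_t lamE an bn.
have [|ndvd dvd szm] := monomial_sym_tLambda hz lam_t lamE.
  by move=> x; rewrite !inE => /orP[] /eqP ->.
rewrite !count_mem_cons eqxx addn0 add1n => ->.
rewrite !big_cons big_nil addr0 in dvd.
by rewrite zeta_marked2 // ndvd // !inE eqxx ?orbT.
Qed.

Lemma monomial_sym_triple (F : fieldType) (z : F) n k m a b c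
    (lam : (k * n).-tuple int) : n.-primitive_root z -> lam \in tLambda n k ->
  tval lam = [:: a; b; c] ++ nseq m n%:Z -> a < n%:Z -> b < n%:Z -> c < n%:Z ->
  ((b == a) + (c == a)).+1%:R * monomial_sym lam (zeta_point z n k) =
  (if b == c then 1 else 2) * (k * n)%:R.
Proof.
move=> hz lam_t lamE an bn cn.
have [|ndvd dvd szm] := monomial_sym_tLambda hz lam_t lamE.
  by move=> x; rewrite !inE => /or3P[] /eqP ->.
rewrite !count_mem_cons eqxx addn0 add1n => ->.
rewrite !big_cons big_nil addr0 addrA in dvd.
by rewrite zeta_marked3 // ndvd // !inE eqxx ?orbT.
Qed.

Theorem theorem1p3 (R : realType) (n k : nat) (z : R[i])
    (n_gt0 : (0 < n)%N) (k_gt0 : (0 < k)%N) (hz : n.-primitive_root z) :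
  (* (1) *)
  (forall (lam : (k * n).-tuple int) (l1 l2 : int),
     lam \in tLambda n k ->
     tval lam = [:: l1; l2] ++ nseq (k * n - 2) n%:Z ->
     l1 <= l2 -> l2 < n%:Z ->
     (l1 = l2 -> monomial_sym lam (zeta_point z n k) = - (n%:R / 2%:R * k%:R)
                 /\ - (n%:R / 2%:R * k%:R) != 0 :> R[i]) /\
     (l1 <> l2 -> monomial_sym lam (zeta_point z n k) = - (k%:R * n%:R)
                 /\ - (k%:R * n%:R) != 0 :> R[i])) /\
  (* (2) *)
  (forall (lam : (k * n).-tuple int) (l1 : int),
     lam \in tLambda n k ->
     tval lam = [:: l1; l1; l1] ++ nseq (k * n - 3) n%:Z ->
     l1 < n%:Z ->
     monomial_sym lam (zeta_point z n k) = n%:R / 3%:R * k%:R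
     /\ n%:R / 3%:R * k%:R != 0 :> R[i]) /\
  (* (3) *)
  (forall (lam : (k * n).-tuple int) (l1 l2 : int),
     lam \in tLambda n k ->
     tval lam = [:: l1; l1; l2] ++ nseq (k * n - 3) n%:Z \/
     tval lam = [:: l1; l2; l2] ++ nseq (k * n - 3) n%:Z ->
     l1 < l2 -> l2 < n%:Z ->
     monomial_sym lam (zeta_point z n k) = k%:R * n%:R
     /\ k%:R * n%:R != 0 :> R[i]) /\
  (* (4) *)
  (forall (lam : (k * n).-tuple int) (l1 l2 l3 : int),
     lam \in tLambda n k ->
     tval lam = [:: l1; l2; l3] ++ nseq (k * n - 3) n%:Z ->
     l1 < l2 -> l2 < l3 -> l3 < n%:Z ->
     monomial_sym lam (zeta_point z n k) = 2%:R * k%:R * n%:R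
     /\ 2%:R * k%:R * n%:R != 0 :> R[i]) /\
  (* (5); the division by n is exact because n divides a * l1 *)
  (forall (lam : (k * n).-tuple int) (l1 : int) (a : nat),
     tval lam = nseq a l1 ++ nseq (k * n - a) n%:Z ->
     ~~ (n %| l1)%Z -> (n %| a%:Z * l1)%Z -> (0 <= a <= k * n)%N ->
     let g := gcdn `|l1|%N n in
     let b := ((a * g) %/ n)%N in
     monomial_sym lam (zeta_point z n k) = (-1) ^+ (a + b) * 'C(k * g, b)%:R
     /\ (-1) ^+ (a + b) * 'C(k * g, b)%:R != 0 :> R[i]) /\
  (* (6) *)
  (forall (lam lam' : (k * n).-tuple int) (l1 l2 : int) (a : nat),
     tval lam = nseq a l1 ++ nseq (k * n - a) l2 ->
     tval lam' = nseq (k * n - a) (l2 - l1) ++ nseq a n%:Z ->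
     ~~ (n %| l2 - l1)%Z -> (1 <= a <= k * n)%N ->
     monomial_sym lam (zeta_point z n k) =
     (-1) ^ (k%:Z * (n%:Z + 1) * l1) * monomial_sym lam' (zeta_point z n k)) /\
  (* (7) *)
  (forall (l : nat), (0 < l)%N ->
     forall mu : ((k + l) * n).-tuple int, mu \in Lambda n (k + l) ->
     monomial_sym mu (zeta_point z n (k + l)) =
     \sum_(lam \in [set lam | lam \in Lambda n k /\ triangleleft lam mu]%classic)
       monomial_sym lam (zeta_point z n k) *
       monomial_sym (removal mu lam) (zeta_point z n l)).
Proof.
have nat0 m : (0 < m)%N -> m%:R != 0 :> R[i] by rewrite pnatr_eq0 -lt0n.
have n0 := nat0 _ n_gt0; have k0 := nat0 _ k_gt0.
have two0 := nat0 2%N isT; have three0 := nat0 3%N isT.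
split.
  move=> lam l1 l2 lam_t lamE l12 l2n; have l1n := le_lt_trans l12 l2n.
  have := monomial_sym_pair hz lam_t lamE l1n l2n; rewrite natrM => H.
  split=> [El|/eqP El].
    split; last by rewrite oppr_eq0 !mulf_neq0 ?invr_neq0.
    by apply: (mulfI two0); move: H; rewrite -El eqxx => ->; field.
  split; last by rewrite oppr_eq0 mulf_neq0.
  by move: H; rewrite eq_sym (negPf El) mul1r.
split.
  move=> lam l1 lam_t lamE l1n.
  have := monomial_sym_triple hz lam_t lamE l1n l1n l1n.
  rewrite eqxx natrM mul1r => E.
  split; last by rewrite !mulf_neq0 ?invr_neq0.
  by apply: (mulfI three0); rewrite E; field.
split.
  move=> lam l1 l2 lam_t lamE l12 l2n; have l1n := lt_trans l12 l2n.
  split; last by rewrite mulf_neq0.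
  case: lamE => lamE.
    have := monomial_sym_triple hz lam_t lamE l1n l1n l2n.
    by rewrite eqxx (gt_eqF l12) (lt_eqF l12) natrM => /(mulfI two0).
  have := monomial_sym_triple hz lam_t lamE l1n l2n l2n.
  by rewrite eqxx (gt_eqF l12) natrM !mul1r.
split.
  move=> lam l1 l2 l3 lam_t lamE l12 l23 l3n.
  have l2n := lt_trans l23 l3n; have l1n := lt_trans l12 l2n.
  split; last by rewrite !mulf_neq0.
  have := monomial_sym_triple hz lam_t lamE l1n l2n l3n.
  rewrite (gt_eqF l12) (gt_eqF (lt_trans l12 l23)) (lt_eqF l23).
  by rewrite natrM mul1r mulrA.
split.
  move=> lam l1 a lamE n_l1 n_al1 a_le g b.
  have [coefE b_le] := coef_prod_zeta hz n_al1 a_le.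
  split; last first.
    by rewrite mulf_neq0 ?signr_eq0 // nat0 // bin_gt0.
  rewrite -coefE monomial_symE lamE msym_nseq2 ?size_tuple ?subnKC //.
    rewrite (eq_big_seq (fun x => (x ^ l1)%:P + 'X)) // => x xz.
    by rewrite (zeta_exprz_order hz xz) scale1r.
  by apply: contraNneq n_l1 => ->; rewrite dvdzz.
split.
  move=> lam lam' l1 l2 a lamE lam'E n_l /andP[_ a_le].
  (* On the entries of lam', adding l1 up to the identification of n with 0. *)
  pose f (u : int) := if u == n%:Z then l1 else u + l1.
  have l_n : l2 - l1 != n%:Z by apply: contraNneq n_l => ->; rewrite dvdzz.
  have lam_f : perm_eq lam (map f lam').
    rewrite lamE lam'E map_cat !map_nseq /f eqxx (negPf l_n) subrK.
    by rewrite perm_catC.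
  rewrite !monomial_symE (msym_perm _ lam_f) (msym_map (g := fun x => x ^ l1)).
  - have -> : \prod_(x <- zeta_point z n k) x ^ l1 =
        (\prod_(x <- zeta_point z n k) x) ^ l1.
      apply: (big_ind2 (fun x y => x = y ^ l1)) => // [|x1 y1 x2 y2 -> ->].
        by rewrite exp1rz.
      by rewrite expfzMl.
    rewrite prod_zeta // exprnP exprz_exp; congr (_ ^ _ * _).
    by rewrite -addn1 PoszM PoszD.
  - by rewrite !size_tuple.
  - move=> u v; rewrite lam'E !mem_cat !mem_nseq.
    have n_l' : l2 - l1 != 0 by apply: contraNneq n_l => ->; rewrite dvdz0.
    have fl : f (l2 - l1) = l2 by rewrite /f (negPf l_n) subrK.
    have fn : f n%:Z = l1 by rewrite /f eqxx.
    have l12 : l2 != l1 by rewrite -subr_eq0.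
    move=> /orP[] /andP[_ /eqP ->] /orP[] /andP[_ /eqP ->] //; rewrite fl fn.
      by move/eqP; rewrite (negPf l12).
    by move/eqP; rewrite eq_sym (negPf l12).
  - move=> x u xz _; have x0 : x != 0.
      by apply: contraNneq (zeta_point_neq0 k hz) => <-.
    rewrite /f; case: eqP => [->|_]; last by rewrite expfzDr // mulrC.
    by rewrite (zeta_exprz_order hz xz) mulr1.
move=> l _ mu mu_L; rewrite monomial_symE zeta_point_cat //.
rewrite fsbig_finite; last first.
  by apply: sub_finite_set (finite_Lambda n k) => lam [].
set L := finmap.enum_fset _; rewrite (@msym_cat _ _ _ _ _ L
  (fun lam : (k * n).-tuple int => tval lam) (fun lam => tval (removal mu lam))).
- by apply: eq_bigr => lam _; rewrite !monomial_symE.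
- move=> lam; rewrite /L in_fset_set; last first.
    by apply: sub_finite_set (finite_Lambda n k) => ? [].
  by rewrite inE !size_tuple => -[lam_L lam_mu]; have [] := val_removal lam_L lam_mu.
- by move=> nu numu; rewrite size_tuple count_Lambda_prefix.
Qed.
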